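(* Let $n\geq 1$ and let $\widetilde{a}_1,\dots,\widetilde{a}_n$ be crisp fuzzy numbers with $\widetilde{a}_i\geq_{OT}\widetilde{0}$ for all $i=1,\dots,n$ and $\sum_{i=1}^n\widetilde{a}_i=\widetilde{1}$. Then the weighted arithmetic mean $M_w:\mathfrak{T}(\mathbb{R})^n\to\mathfrak{T}(\mathbb{R})$, $M_w(A_1,\dots,A_n)=\sum_{i=1}^n\widetilde{a}_iA_i$, is an $OT$-FTA.
   Context: A triangular fuzzy number (TFN) is identified with a triple $(a,b,c)\in\mathbb{R}^3$ with $a\leq b\leq c$; $\mathfrak{T}(\mathbb{R})$ is the set of all TFNs. For $r\in\mathbb{R}$, $\widetilde{r}=(r,r,r)$ is the crisp fuzzy number at $r$. Addition is $(a_1,b_1,c_1)+(a_2,b_2,c_2)=(a_1+a_2,b_1+b_2,c_1+c_2)$, and multiplication by a crisp number is $\widetilde{r}(a,b,c)=(ra,rb,rc)$ if $r\geq 0$ and $(rc,rb,ra)$ if $r<0$. $(a_1,b_1,c_1)\leq_{OT}(a_2,b_2,c_2)$ if and only if $b_1<b_2$; or $b_1=b_2$ and $c_1<c_2$; or $b_1=b_2$, $c_1=c_2$ and $a_1\leq a_2$; $B\geq_{OT}A$ means $A\leq_{OT}B$. This is a total order on $\mathfrak{T}(\mathbb{R})$; $\mathrm{Min}_{\leq_{OT}}$ and $\mathrm{Max}_{\leq_{OT}}$ denote the minimum and maximum of a finite set with respect to it. On $\mathfrak{T}(\mathbb{R})^n$, $(A_1,\dots,A_n)\leq_{OT^n}(B_1,\dots,B_n)$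 if and only if $A_i\leq_{OT}B_i$ for all $i=1,\dots,n$. A function $E:\mathfrak{T}(\mathbb{R})^n\to\mathfrak{T}(\mathbb{R})$ is $OT$-increasing if $E(\overrightarrow{A})\leq_{OT}E(\overrightarrow{B})$ whenever $\overrightarrow{A}\leq_{OT^n}\overrightarrow{B}$. It is a function of type average ($OT$-FTA) if it is $OT$-increasing and, for all $A_1,\dots,A_n\in\mathfrak{T}(\mathbb{R})$, $\mathrm{Min}_{\leq_{OT}}\{A_1,\dots,A_n\}\leq_{OT}E(A_1,\dots,A_n)\leq_{OT}\mathrm{Max}_{\leq_{OT}}\{A_1,\dots,A_n\}$. *)

(* Defs.v *)
From HB Require Import structures.
From mathcomp Require Import all_boot all_order all_algebra.
From mathcomp Require Import reals.

Set Implicit Arguments.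
Unset Strict Implicit.
Unset Printing Implicit Defensive.

Import Order.TTheory GRing.Theory Num.Theory.
Local Open Scope ring_scope.

Definition tfn_axiom (R : realType) (t : R * R * R) : bool :=
  (t.1.1 <= t.1.2) && (t.1.2 <= t.2).

Record tfn (R : realType) := Tfn {
  tfn_val :> R * R * R;
  tfn_valP : tfn_axiom tfn_val
}.

HB.instance Definition _ (R : realType) := [isSub for @tfn_val R].
HB.instance Definition _ (R : realType) := [Choice of tfn R by <:].

Section Tfn.
Variable R : realType.
Implicit Types (A B C : tfn R) (r : R).

Definition lo A : R := (tfn_val A).1.1.
Definition mid A : R := (tfn_val A).1.2.
Definition hi A : R := (tfn_val A).2.

Lemma lo_mid A : lo A <= mid A. Proof. by case/andP: (tfn_valP A). Qed.
Lemma mid_hi A : mid A <= hi A. Proof. by case/andP: (tfn_valP A). Qed.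

Lemma tfn_eq A B : lo A = lo B -> mid A = mid B -> hi A = hi B -> A = B.
Proof.
rewrite /lo /mid /hi => h1 h2 h3; apply: val_inj => /=; move: h1 h2 h3.
by case: (tfn_val A) (tfn_val B) => [[a b] c] [[a' b'] c'] /= -> -> ->.
Qed.

Fact crisp_subproof r : tfn_axiom (r, r, r).
Proof. by rewrite /tfn_axiom /= lexx. Qed.
Definition crisp r : tfn R := Tfn (crisp_subproof r).

Fact addt_subproof A B : tfn_axiom (lo A + lo B, mid A + mid B, hi A + hi B).
Proof. by rewrite /tfn_axiom /= !lerD ?lo_mid ?mid_hi. Qed.
Definition addt A B : tfn R := Tfn (addt_subproof A B).

Fact addtA : associative addt.
Proof. by move=> A B C; apply: tfn_eq; rewrite /lo /mid /hi /= addrA. Qed.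
Fact addtC : commutative addt.
Proof. by move=> A B; apply: tfn_eq; rewrite /lo /mid /hi /= addrC. Qed.
Fact add0t : left_id (crisp 0) addt.
Proof. by move=> A; apply: tfn_eq; rewrite /lo /mid /hi /= add0r. Qed.
HB.instance Definition _ := GRing.isNmodule.Build (tfn R) addtA addtC add0t.

Fact cmul_subproof r A :
  tfn_axiom (if 0 <= r then (r * lo A, r * mid A, r * hi A)
             else (r * hi A, r * mid A, r * lo A)).
Proof.
have h1 := lo_mid A; have h2 := mid_hi A.
case: ifPn => [r0|]; first by rewrite /tfn_axiom /= !ler_wpM2l.
by rewrite -ltNge => /ltW r0; rewrite /tfn_axiom /= !ler_wnM2l.
Qed.
(* [cmul r A] is the product of the crisp number [crisp r] by [A]. *)
Definition cmul r A : tfn R := Tfn (cmul_subproof r A).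

Definition leOT A B : bool :=
  [|| mid A < mid B,
      (mid A == mid B) && (hi A < hi B)
    | [&& mid A == mid B, hi A == hi B & lo A <= lo B]].

Definition ltOT A B : bool := (B != A) && leOT A B.

Fact leOT_refl : reflexive leOT.
Proof. by move=> A; rewrite /leOT !eqxx lexx !orbT. Qed.

Fact leOT_anti : antisymmetric leOT.
Proof.
move=> A B; rewrite /leOT.
case: (ltgtP (mid A) (mid B)) => //= hm.
case: (ltgtP (hi A) (hi B)) => //= hh hl.
exact: tfn_eq (le_anti hl) hm hh.
Qed.

Fact leOT_trans : transitive leOT.
Proof.
move=> B A C; rewrite /leOT.
case: (ltgtP (mid A) (mid B)) => //= h1; case: (ltgtP (mid B) (mid C)) => //= h2.
- by rewrite (lt_trans h1 h2).
- by rewrite -h2 h1.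
- by rewrite h1 h2.
rewrite h1 h2 eqxx ltxx /=.
case: (ltgtP (hi A) (hi B)) => //= h3; case: (ltgtP (hi B) (hi C)) => //= h4.
- by rewrite (lt_trans h3 h4).
- by rewrite -h4 h3.
- by rewrite h3 h4.
by rewrite h3 h4 eqxx ltxx /=; apply: le_trans.
Qed.

Fact leOT_total : total leOT.
Proof.
move=> A B; rewrite /leOT.
case: (ltgtP (mid A) (mid B)) => //= _.
by case: (ltgtP (hi A) (hi B)) => //= _; apply: le_total.
Qed.

End Tfn.

Fact OT_display : Order.disp_t. Proof. exact: Order.Disp tt tt. Qed.

HB.instance Definition _ (R : realType) :=
  @Order.isPOrder.Build OT_display (tfn R) (@leOT R) (@ltOT R)
    (fun _ _ => erefl) (@leOT_refl R) (@leOT_anti R) (@leOT_trans R).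
HB.instance Definition _ (R : realType) :=
  Order.POrder_isTotal.Build OT_display (tfn R) (@leOT_total R).

Notation "A <=_OT B" := (leOT A B) (at level 70, no associativity).

Lemma leOTE (R : realType) (A B : tfn R) : (A <=_OT B) = (A <= B)%O.
Proof. by []. Qed.

Section MinMax.
Variable R : realType.
Implicit Types (A : tfn R) (s : seq (tfn R)).

(* Minimum and maximum of a nonempty finite family; the value on [::] is
   irrelevant. *)
Definition minOT s : tfn R := \big[Order.min/head 0 s]_(A <- s) A.
Definition maxOT s : tfn R := \big[Order.max/head 0 s]_(A <- s) A.

Lemma minOT_mem s : s != [::] -> minOT s \in s.
Proof.
case: s => // A s _; rewrite /minOT /=.
rewrite big_seq; elim/big_ind: _ => [|B C hB hC|//]; first exact: mem_head.
by rewrite minEle; case: ifP.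
Qed.

Lemma maxOT_mem s : s != [::] -> maxOT s \in s.
Proof.
case: s => // A s _; rewrite /maxOT /=.
rewrite big_seq; elim/big_ind: _ => [|B C hB hC|//]; first exact: mem_head.
by rewrite maxEle; case: ifP.
Qed.

Lemma minOT_le s A : A \in s -> minOT s <=_OT A.
Proof.
rewrite leOTE /minOT; elim: s (head 0 s) => // B s IH x; rewrite inE big_cons.
by rewrite ge_min => /predU1P[->|/IH ->]; rewrite ?lexx ?orbT.
Qed.

Lemma maxOT_ge s A : A \in s -> A <=_OT maxOT s.
Proof.
rewrite leOTE /maxOT; elim: s (head 0 s) => // B s IH x; rewrite inE big_cons.
by rewrite le_max => /predU1P[->|/IH ->]; rewrite ?lexx ?orbT.
Qed.

End MinMax.

Section FTA.
Variables (R : realType) (n : nat).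
Implicit Types (A B : n.-tuple (tfn R)) (E : n.-tuple (tfn R) -> tfn R).

Definition leOTn A B : Prop := forall i : 'I_n, tnth A i <=_OT tnth B i.

Definition OT_increasing E : Prop :=
  forall A B, leOTn A B -> E A <=_OT E B.

Definition OT_FTA E : Prop :=
  OT_increasing E /\
  forall A, (minOT A <=_OT E A) /\ (E A <=_OT maxOT A).

Definition wmean (a : 'I_n -> R) A : tfn R :=
  \sum_(i < n) cmul (a i) (tnth A i).

End FTA.

(* Main.v *)
(* The order OT is lexicographic in (mid, hi, lo), so addition of fuzzy numbers
   and multiplication by a nonnegative crisp number preserve it; hence the
   weighted mean is increasing.  Since the weights sum to 1, the mean of a
   constant family is that constant, and comparing a family with its constant
   minimum and maximum gives the two bounds. *)

Require Import Defs.
From mathcomp Require Import all_boot all_order all_algebra.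
From mathcomp Require Import reals.

Set Implicit Arguments.
Unset Strict Implicit.
Unset Printing Implicit Defensive.

Import Order.TTheory GRing.Theory Num.Theory.
Local Open Scope ring_scope.

(** The three coordinates are additive by computation; the morphism form lets [big_morph] push them
    through sums. *)
Lemma loD (R : realType) : {morph @lo R : A B / A + B >-> A + B}.
Proof. by []. Qed.

Lemma midD (R : realType) : {morph @mid R : A B / A + B >-> A + B}.
Proof. by []. Qed.

Lemma hiD (R : realType) : {morph @hi R : A B / A + B >-> A + B}.
Proof. by []. Qed.

Lemma leOT_add2r (R : realType) (C A B : tfn R) :
  (A + C <=_OT B + C) = (A <=_OT B).
Proof.
by rewrite /leOT !loD !midD !hiD !ltrD2r lerD2r !(inj_eq (addIr _)).
Qed.

Lemma leOT_add (R : realType) (A B C D : tfn R) :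
  A <=_OT B -> C <=_OT D -> A + C <=_OT B + D.
Proof.
move=> AB CD; apply: (@leOT_trans _ (B + C)); first by rewrite leOT_add2r.
by rewrite ![B + _]addrC leOT_add2r.
Qed.

Lemma leOT_sum (R : realType) (I : finType) (F G : I -> tfn R) :
  (forall i, F i <=_OT G i) -> \sum_i F i <=_OT \sum_i G i.
Proof.
move=> FG; elim/big_ind2: _ => [|A B C D|i _]; last exact: FG.
  exact: leOT_refl.
exact: leOT_add.
Qed.

Lemma crisp_ge0 (R : realType) (r : R) : (crisp 0 <=_OT crisp r) = (0 <= r).
Proof. by rewrite /leOT /lo /mid /hi /=; case: ltgtP. Qed.

Lemma lo_cmul (R : realType) (r : R) (A : tfn R) :
  0 <= r -> lo (cmul r A) = r * lo A.
Proof. by rewrite {1}/lo /= => ->. Qed.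

Lemma mid_cmul (R : realType) (r : R) (A : tfn R) : mid (cmul r A) = r * mid A.
Proof. by rewrite {1}/mid /=; case: ifP. Qed.

Lemma hi_cmul (R : realType) (r : R) (A : tfn R) :
  0 <= r -> hi (cmul r A) = r * hi A.
Proof. by rewrite {1}/hi /= => ->. Qed.

(** With [0 <= r] the outer coordinates are not swapped, so all three are scaled in place and the
    lexicographic comparison survives. *)
Lemma leOT_cmul (R : realType) (r : R) (A B : tfn R) :
  0 <= r -> A <=_OT B -> cmul r A <=_OT cmul r B.
Proof.
move=> r0; rewrite /leOT !mid_cmul !hi_cmul // !lo_cmul //.
(* Scaling by 0 destroys strict inequalities, but then both products have all coordinates 0 and the
   last clause of the order holds. Scaling by [r > 0] preserves and reflects each clause. *)
move: r0; rewrite le_eqVlt => /predU1P[<-|r0].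
  by rewrite !mul0r eqxx lexx !orbT.
by rewrite !ltr_pM2l // ler_pM2l // !(inj_eq (mulfI (lt0r_neq0 r0))).
Qed.

(** Weights of mixed sign would mix [lo A] with [hi A]; with nonnegative ones, each coordinate of
    [A] factors out of its sum, leaving the total weight 1. *)
Lemma sum_cmul (R : realType) (I : finType) (a : I -> R) (A : tfn R) :
    (forall i, 0 <= a i) -> \sum_i a i = 1 ->
  \sum_i cmul (a i) A = A.
Proof.
move=> a0 a1; apply: tfn_eq.
- rewrite (big_morph _ (@loD R) (erefl : lo 0 = 0)).
  by under eq_bigr do rewrite lo_cmul //; rewrite -mulr_suml a1 mul1r.
- rewrite (big_morph _ (@midD R) (erefl : mid 0 = 0)).
  by under eq_bigr do rewrite mid_cmul; rewrite -mulr_suml a1 mul1r.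
- rewrite (big_morph _ (@hiD R) (erefl : hi 0 = 0)).
  by under eq_bigr do rewrite hi_cmul //; rewrite -mulr_suml a1 mul1r.
Qed.

Theorem proposition5p2 (R : realType) (n : nat) (hn : (1 <= n)%N)
    (a : 'I_n -> R)
    (ha : forall i : 'I_n, crisp 0 <=_OT crisp (a i))
    (ha1 : \sum_(i < n) crisp (a i) = crisp 1) :
  OT_FTA (wmean a).
Proof.
have a0 i : 0 <= a i by rewrite -crisp_ge0.
have a1 : \sum_i a i = 1.
  (* The middle coordinate turns the identity between crisp numbers into one between reals. *)
  by have := congr1 (@mid R) ha1; rewrite (big_morph _ (@midD R) (erefl : mid 0 = 0)).
split=> [A B AB|A]; first by apply: leOT_sum => i; apply: leOT_cmul.
split.
  rewrite -[minOT A](sum_cmul _ a0 a1); apply: leOT_sum => i.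
  by apply: leOT_cmul => //; apply/minOT_le/mem_tnth.
rewrite -[maxOT A](sum_cmul _ a0 a1); apply: leOT_sum => i.
by apply: leOT_cmul => //; apply/maxOT_ge/mem_tnth.
Qed.
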